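(* Let $m\ge 0$ and let ${\sf H}_m:\mathcal A_m\to\mathcal H_m$ be the projector onto $\mathcal H_m$ along the decomposition $\mathcal A_m=\mathcal H_m\oplus Q\mathcal A_{m-2}$ (with $\mathcal A_{-1}=\mathcal A_{-2}=0$). Then for every $p\in\mathcal A_m$ $${\sf H}_m\,p=\sum_{k=0}^{\lfloor m/2\rfloor}\alpha_k\,\hat Q^k\Delta_q^k\,p ,\qquad \alpha_k=\frac{q^{2k^2-2mk-k}(1-q^2)^{2k}}{(1+q^{N-2})^{2k}\,(q^{-N-2m+4};q^2)_k\,(q^2;q^2)_k}.$$
   Context: Fix an integer $N\ge 3$ and write $N=2n$ or $N=2n+1$; put $j'=N-j+1$. Let $q\in\mathbb C\setminus\{0\}$ be not a root of unity (with a fixed $q^{1/2}$), $[a]=\frac{1-q^a}{1-q}$, $[a]_q=\frac{q^a-q^{-a}}{q-q^{-1}}$, $(a;q)_s=(1-a)(1-aq)\cdots(1-aq^{s-1})$. Put $(\rho_1,\dots,\rho_N)=(n-\frac12,n-\frac32,\dots,\frac12,0,-\frac12,\dots,-n+\frac12)$ if $N=2n+1$ and $(\rho_1,\dots,\rho_N)=(n-1,\dots,1,0,0,-1,\dots,-n+1)$ if $N=2n$. $\mathcal A$ is the associative unital $\mathbb C$-algebra generated by $x_1,\dots,x_N$ with relations: $x_ix_j=qx_jx_i$ for $i<j$, $i\neq j'$; $x_{i'}x_i-x_ix_{i'}=\frac{q-q^{-1}}{q^{\rho_i-1}+q^{-\rho_i+1}}\sum_{j=i+1}^{(i+1)'}q^{\rho_{j'}}x_jx_{j'}$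 for $i<n$; $x_{n'}x_n-x_nx_{n'}=(q^{1/2}-q^{-1/2})x_{n+1}^2$ if $N=2n+1$; $x_{n'}x_n=x_nx_{n'}$ if $N=2n$. The monomials $\mathbf x^\nu=x_1^{\nu_1}\cdots x_N^{\nu_N}$ form a basis of $\mathcal A$; $\mathcal A_m$ is the span of those with $|\nu|=\nu_1+\dots+\nu_N=m$. $Q=\sum_{i=1}^Nq^{\rho_{i'}}x_ix_{i'}$ (a central element), and $\hat Q$ is the operator of left multiplication by $Q$. The $q$-Laplace operator $\Delta_q$ on $\mathcal A$ acts on the basis by $$\Delta_q\mathbf x^\nu=(1+q^{N-2})q^{|\nu|-1}\Big(\sum_{j=1}^n[\nu_j]_q[\nu_{j'}]_q\,q^{-\rho_j+d_j}\,\mathbf x^{\nu-\varepsilon_j-\varepsilon_{j'}}+[\nu_{n+1}-1][\nu_{n+1}]\frac{q^{|\nu|-2\nu_{n+1}+2}}{1+q}\,\mathbf x^{\nu-2\varepsilon_{n+1}}\Big),$$ with $d_j=\nu_1+\dots+\nu_{j-1}+\nu_{(j-1)'}+\dots+\nu_{1'}$, $\varepsilon_i$ the $i$th unit vector, and the last summand omitted if $N=2n$. $\mathcal H_m=\{p\in\mathcal A_m:\Delta_qp=0\}$. It is known that $\mathcal A_m=\mathcal H_m\oplus Q\mathcal A_{m-2}$ for $m\ge2$; for $m=0,1$, $\mathcal H_m=\mathcal A_m$. *)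

(* Defs.v *)
From HB Require Import structures.
From mathcomp Require Import all_boot all_order all_algebra.
From mathcomp Require Import boolp reals complex.
From mathcomp Require Import monalg.

Set Implicit Arguments.
Unset Strict Implicit.
Unset Printing Implicit Defensive.

Import GRing.Theory.
Local Open Scope ring_scope.

(* Indices run over 'I_N = {0, ..., N-1}: the 1-based index j is the         *)
(* ordinal j - 1, the involution j' = N - j + 1 is rev_ord, n is N./2, and    *)
(* for odd N the middle index n + 1 is the ordinal of value N./2.  Throughout *)
(* s stands for the fixed square root q^(1/2), so that q^(a/2) is s ^ a.      *)

(* Twice rho, which makes it an integer. *)
Definition rho2 (N : nat) (i : 'I_N) : int :=
  if (i < N./2)%N then N%:Z - 2 - i.*2%:Z
  else if odd N && (i == N./2 :> nat) then 0
  else N%:Z - i.*2%:Z.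

Section FreeAlgebra.
Variables (F : fieldType) (N : nat).

(* The free associative algebra: words in the generators as a basis. *)
Definition freeAlg : lalgType F := {malg F[{fmonom 'I_N}]}.

Definition freeGen (i : 'I_N) : freeAlg := << fmu i >>.

Definition two_sided_ideal (J : freeAlg -> Prop) : Prop :=
  [/\ J 0, forall f g, J f -> J g -> J (f + g),
      forall f g, J g -> J (f * g) & forall f g, J f -> J (f * g)].

Definition ideal_generated (r : freeAlg -> Prop) (f : freeAlg) : Prop :=
  forall J, two_sided_ideal J -> (forall g, r g -> J g) -> J f.

End FreeAlgebra.

Section QuantumSpace.
Variables (F : fieldType) (N : nat) (q s : F).

(* The differences of the two sides of the defining relations, evaluated at a *)
(* family X of elements of an algebra. *)
Inductive relator (L : lalgType F) (X : 'I_N -> L) : L -> Prop :=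
| rel_qcomm (i j : 'I_N) :
    (i < j)%N -> i != rev_ord j ->
    relator X (X i * X j - q *: (X j * X i))
| rel_conj (i : 'I_N) :
    (i.+1 < N./2)%N ->
    relator X (X (rev_ord i) * X i - X i * X (rev_ord i)
      - ((q - q^-1) / (s ^ (rho2 i - 2) + s ^ (2 - rho2 i))) *:
          \sum_(j < N | (i < j)%N && (j < rev_ord i)%N)
             s ^ rho2 (rev_ord j) *: (X j * X (rev_ord j)))
| rel_mid_odd (i c : 'I_N) :
    odd N -> i.+1 = N./2 -> c = N./2 :> nat ->
    relator X (X (rev_ord i) * X i - X i * X (rev_ord i)
      - (s - s^-1) *: X c ^+ 2)
| rel_mid_even (i : 'I_N) :
    ~~ odd N -> i.+1 = N./2 ->
    relator X (X (rev_ord i) * X i - X i * X (rev_ord i)).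

(* A character killing the generators kills the relators. *)
Lemma relator_char (L : lalgType F) (X : 'I_N -> L) (phi : {rmorphism L -> F})
    (f : L) :
  (forall a g, phi (a *: g) = a * phi g) -> (forall i, phi (X i) = 0) ->
  relator X f -> phi f = 0.
Proof.
move=> phiZ phiX; case=> [i j _ _|i _|i c _ _ _|i _ _].
- by rewrite rmorphB phiZ !rmorphM !phiX !mulr0 subr0.
- rewrite !rmorphB phiZ !rmorphM rmorph_sum !phiX mulr0 big1 ?mulr0 ?subr0 //.
  by move=> j _; rewrite phiZ rmorphM phiX mul0r mulr0.
- by rewrite !rmorphB phiZ rmorphXn !rmorphM !phiX expr2 !mulr0 !subr0.
- by rewrite rmorphB !rmorphM !phiX mulr0 subr0.
Qed.

Local Notation T := (freeAlg F N).
Local Notation X := (@freeGen F N).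

Definition relIdeal : {pred T} := fun f => `[< ideal_generated (relator X) f >].

Lemma relIdealP (f : T) : reflect (ideal_generated (relator X) f) (f \in relIdeal).
Proof. exact: asboolP. Qed.

Lemma relIdeal_mull (f g : T) : g \in relIdeal -> f * g \in relIdeal.
Proof.
move=> /relIdealP gI; apply/relIdealP => J JI Jr.
by case: (JI) => _ _ JM _; apply: JM; apply: gI.
Qed.

Lemma relIdeal_mulr (f g : T) : f \in relIdeal -> f * g \in relIdeal.
Proof.
move=> /relIdealP fI; apply/relIdealP => J JI Jr.
by case: (JI) => _ _ _ JM; apply: JM; apply: fI.
Qed.

Lemma relIdeal_scale (a : F) (f : T) : f \in relIdeal -> a *: f \in relIdeal.
Proof. by move=> fI; rewrite -[f]mul1r scalerAl relIdeal_mull. Qed.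

Lemma relIdeal_zmod_closed : zmod_closed relIdeal.
Proof.
split; first by apply/relIdealP => J [].
move=> f g /relIdealP fI gI.
have /relIdealP ngI : - g \in relIdeal by rewrite -mulN1r relIdeal_mull.
apply/relIdealP => J JI Jr; case: (JI) => _ JD _ _.
by apply: JD; [apply: fI | apply: ngI].
Qed.

HB.instance Definition _ :=
  GRing.isZmodClosed.Build T relIdeal relIdeal_zmod_closed.

(* The algebra generated by x_1, ..., x_N with the above relations. *)
Definition qspace : Type := {ideal_quot relIdeal}.

HB.instance Definition _ := Choice.on qspace.
HB.instance Definition _ := GRing.Zmodule.on qspace.

Definition qproj (f : T) : qspace := \pi_({ideal_quot relIdeal})%qT f.

Lemma qproj_eq (f g : T) : (qproj f == qproj g) = (f - g \in relIdeal).
Proof. by rewrite -Quotient.idealrBE. Qed.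

Lemma qproj_repr (a : qspace) : qproj (repr a) = a.
Proof. exact: reprK. Qed.

Lemma qprojD (f g : T) : qproj (f + g) = qproj f + qproj g.
Proof. exact: (raddfD \pi_({ideal_quot relIdeal})%qT). Qed.

Lemma repr_qproj (f : T) : repr (qproj f) - f \in relIdeal.
Proof. by rewrite -qproj_eq qproj_repr. Qed.

Definition qone : qspace := qproj 1.
Definition qmul (a b : qspace) : qspace := qproj (repr a * repr b).
Definition qscale (c : F) (a : qspace) : qspace := qproj (c *: repr a).

Lemma qprojM (f g : T) : qmul (qproj f) (qproj g) = qproj (f * g).
Proof.
apply/eqP; rewrite qproj_eq.
set f' := repr _; set g' := repr _.
have -> : f' * g' - f * g = (f' - f) * g' + f * (g' - g).
  by rewrite mulrBl mulrBr addrA addrNK.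
by apply: rpredD; [apply: relIdeal_mulr | apply: relIdeal_mull];
  apply: repr_qproj.
Qed.

Lemma qprojZ (c : F) (f : T) : qscale c (qproj f) = qproj (c *: f).
Proof.
by apply/eqP; rewrite qproj_eq -scalerBr relIdeal_scale // repr_qproj.
Qed.

Lemma qmulA : associative qmul.
Proof.
move=> a b c; rewrite -(qproj_repr a) -(qproj_repr b) -(qproj_repr c).
by rewrite !qprojM mulrA.
Qed.

Lemma qmul1l : left_id qone qmul.
Proof. by move=> a; rewrite -(qproj_repr a) qprojM mul1r. Qed.

Lemma qmul1r : right_id qone qmul.
Proof. by move=> a; rewrite -(qproj_repr a) qprojM mulr1. Qed.

Lemma qmulDl : left_distributive qmul +%R.
Proof.
move=> a b c; rewrite -(qproj_repr a) -(qproj_repr b) -(qproj_repr c).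
by rewrite -qprojD !qprojM mulrDl qprojD.
Qed.

Lemma qmulDr : right_distributive qmul +%R.
Proof.
move=> a b c; rewrite -(qproj_repr a) -(qproj_repr b) -(qproj_repr c).
by rewrite -qprojD !qprojM mulrDr qprojD.
Qed.

(* The relators have no constant term, so the ideal is proper. *)
Lemma relIdeal_cst (f : T) :
  f \in relIdeal -> mcoeff (mone : {fmonom 'I_N}) f = 0.
Proof.
have [phi phiE] : exists phi : {rmorphism T -> F},
    forall g, phi g = mcoeff (mone : {fmonom 'I_N}) g.
  by exists (mcoeff (mone : {fmonom 'I_N})).
rewrite -phiE => /relIdealP /(_ (fun g => phi g = 0)); apply.
- split=> [|g h g0 h0|g h h0|g h g0].
  + exact: rmorph0.
  + by rewrite rmorphD g0 h0 addr0.
  + by rewrite rmorphM h0 mulr0.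
  + by rewrite rmorphM g0 mul0r.
- move=> g; apply: relator_char => [a h|i]; rewrite !phiE.
    exact: mcoeffZ.
  by rewrite mcoeffU1 fm1_eq1.
Qed.

Lemma qone_neq0 : qone != 0.
Proof.
have -> : 0 = qproj 0.
  by apply: esym; apply: (raddf0 \pi_({ideal_quot relIdeal})%qT).
rewrite qproj_eq subr0; apply/negP => /relIdeal_cst /eqP.
by rewrite mcoeff1 eqxx oner_eq0.
Qed.

HB.instance Definition _ := GRing.Zmodule_isNzRing.Build qspace
  qmulA qmul1l qmul1r qmulDl qmulDr qone_neq0.

Lemma qscaleA (a b : F) (v : qspace) : qscale a (qscale b v) = qscale (a * b) v.
Proof. by rewrite -(qproj_repr v) !qprojZ scalerA. Qed.

Lemma qscale1 : left_id 1 qscale.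
Proof. by move=> v; rewrite -(qproj_repr v) qprojZ scale1r. Qed.

Lemma qscaleDr : right_distributive qscale +%R.
Proof.
move=> a u v; rewrite -(qproj_repr u) -(qproj_repr v).
by rewrite -qprojD !qprojZ scalerDr qprojD.
Qed.

Lemma qscaleDl (v : qspace) : {morph qscale^~ v : a b / a + b}.
Proof. by move=> a b /=; rewrite -(qproj_repr v) !qprojZ scalerDl qprojD. Qed.

HB.instance Definition _ := GRing.Zmodule_isLmodule.Build F qspace
  qscaleA qscale1 qscaleDr qscaleDl.

Lemma qscaleAl (a : F) (u v : qspace) : a *: (u * v) = (a *: u) * v.
Proof.
rewrite -(qproj_repr u) -(qproj_repr v).
change (qscale a (qmul (qproj (repr u)) (qproj (repr v)))
  = qmul (qscale a (qproj (repr u))) (qproj (repr v))).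
by rewrite qprojZ !qprojM qprojZ scalerAl.
Qed.

HB.instance Definition _ := GRing.Lmodule_isLalgebra.Build F qspace qscaleAl.

Lemma free_scaleAr (a : F) (f g : T) : a *: (f * g) = f * (a *: g).
Proof.
have Ca (h : T) : h * (a%:MP : T) = a *: h.
  rewrite malgM_def malgZ_def fgmulgU; apply: eq_bigr => w _.
  by rewrite mulm1 mulrC.
by rewrite -[a *: (f * g)]Ca -mulrA Ca.
Qed.

Lemma qscaleAr (a : F) (u v : qspace) : a *: (u * v) = u * (a *: v).
Proof.
rewrite -(qproj_repr u) -(qproj_repr v).
change (qscale a (qmul (qproj (repr u)) (qproj (repr v)))
  = qmul (qproj (repr u)) (qscale a (qproj (repr v)))).
by rewrite qprojZ !qprojM qprojZ free_scaleAr.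
Qed.

HB.instance Definition _ := GRing.Lalgebra_isAlgebra.Build F qspace qscaleAr.

Definition qgen (i : 'I_N) : qspace := qproj (X i).

Local Notation A := qspace.
Local Notation x := qgen.

(* The product of a big operator over 'I_N is taken in increasing order, so   *)
(* this is x_1 ^ nu_1 ... x_N ^ nu_N.                                         *)
Definition qmonomial (nu : {ffun 'I_N -> nat}) : A := \prod_(i < N) x i ^+ nu i.

Definition mdegree (nu : {ffun 'I_N -> nat}) : nat := (\sum_(i < N) nu i)%N.

(* The degree is an integer so that the component is 0 in negative degrees.   *)
Definition homogeneous (m : int) (p : A) : Prop :=
  exists (r : seq {ffun 'I_N -> nat}) (c : {ffun 'I_N -> nat} -> F),
    (forall nu, nu \in r -> (mdegree nu)%:Z = m) /\
    p = \sum_(nu <- r) c nu *: qmonomial nu.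

Definition Qelt : A :=
  \sum_(i < N) s ^ rho2 (rev_ord i) *: (x i * x (rev_ord i)).

Definition Qhat (p : A) : A := Qelt * p.

Definition qint (a : int) : F := (1 - q ^ a) / (1 - q).

Definition qint_sym (a : int) : F := (q ^ a - q ^ (- a)) / (q - q^-1).

Definition qpoch (a b : F) (k : nat) : F := \prod_(r < k) (1 - a * b ^+ r).

Definition dshift (nu : {ffun 'I_N -> nat}) (j : 'I_N) : nat :=
  (\sum_(k < N | (k < j)%N) (nu k + nu (rev_ord k)))%N.

(* nu - e_j - e_j'; for the middle index of an odd N this is nu - 2 e_j.  The *)
(* subtraction is truncated, but in [qlaplace_monomial] the coefficient is 0  *)
(* whenever truncation occurs.                                                *)
Definition mlower (nu : {ffun 'I_N -> nat}) (j : 'I_N) : {ffun 'I_N -> nat} :=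
  [ffun i => (nu i - (i == j) - (i == rev_ord j))%N].

(* The second sum has one term for odd N and none for even N. *)
Definition qlaplace_monomial (nu : {ffun 'I_N -> nat}) : A :=
  ((1 + q ^+ (N - 2)) * q ^ ((mdegree nu)%:Z - 1)) *:
  (\sum_(j < N | (j < N./2)%N)
      (qint_sym (nu j)%:Z * qint_sym (nu (rev_ord j))%:Z
        * s ^ (- rho2 j + (dshift nu j).*2%:Z)) *: qmonomial (mlower nu j)
   + \sum_(c < N | odd N && (c == N./2 :> nat))
      (qint ((nu c)%:Z - 1) * qint (nu c)%:Z
        * (q ^ ((mdegree nu)%:Z - (nu c).*2%:Z + 2) / (1 + q)))
          *: qmonomial (mlower nu c)).

(* The monomials form a basis of the algebra, so that exactly one linear map  *)
(* has this property.                                                         *)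
Definition is_qlaplace (Delta : {linear A -> A}) : Prop :=
  forall nu, Delta (qmonomial nu) = qlaplace_monomial nu.

Definition harmonic (Delta : A -> A) (m : nat) (p : A) : Prop :=
  homogeneous m%:Z p /\ Delta p = 0.

(* Q A_(m-2), which is 0 for m = 0, 1. *)
Definition Qmultiple (m : nat) (p : A) : Prop :=
  exists2 r, homogeneous (m%:Z - 2) r & p = Qhat r.

(* P sends each element of W to its U-component along W = U (+) V; values of  *)
(* P outside W are irrelevant.                                                *)
Definition projector_along (W U V : A -> Prop) (P : A -> A) : Prop :=
  forall p, W p -> U (P p) /\ V (p - P p).

Definition alpha (m k : nat) : F :=
  q ^ (2 * k%:Z ^+ 2 - 2 * m%:Z * k%:Z - k%:Z) * (1 - q ^+ 2) ^+ (2 * k)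
  / ((1 + q ^+ (N - 2)) ^+ (2 * k)
     * qpoch (q ^ (- N%:Z - 2 * m%:Z + 4)) (q ^+ 2) k
     * qpoch (q ^+ 2) (q ^+ 2) k).

End QuantumSpace.

Arguments Qhat {F N} q s p.
Arguments Qmultiple {F N} q s m p.

(* Main.v *)
Require Import Defs.
From mathcomp Require Import all_boot all_order all_algebra.
From mathcomp Require Import reals complex.
From mathcomp Require Import zify ring.

Set Implicit Arguments.
Unset Strict Implicit.
Unset Printing Implicit Defensive.

Import GRing.Theory.
Local Open Scope ring_scope.
Local Open Scope complex_scope.

(* Let Q_j be the part of Q with indices between j and j', and P_j = Q_j/w_j *)
(* with w_j = q^(rho_j) + q^(-rho_j).  The relations become                   *)
(*   P_j = x_j x_j' + q P_(j+1),  x_j' x_j = x_j x_j' + (q - q^-1) P_(j+1),   *)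
(* so that P_j commutes with x_j, and moving P_1 through x^nu writes Q x^nu   *)
(* as a combination of the x^(nu + e_j + e_j').  In Delta Q - q^2 Q Delta the *)
(* terms that raise at j and lower at k <> j cancel, the diagonal ones        *)
(* telescope over j, and on A_m                                               *)
(*   Delta Q = q^2 Q Delta                                                    *)
(*             + (1 + q^(N-2))^2 q^(3-N) (1 - q^(N+2m)) / (1 - q^2).          *)
(* Iterating, sum_k alpha_k Q^k Delta^k telescopes to 0 on Q A_(m-2), while   *)
(* it is the identity on the kernel of Delta.                                 *)

(** Write [p = h + Q u] with [h] harmonic and [u] of degree m - 2. The operator sum_k alpha_k Q^k
    Delta^k must fix [h] and kill [Q u]. It fixes [h] since alpha_0 = 1 and all other terms contain
    Delta h = 0. On [Q u] it is enough to know how Delta passes Q in each degree ([D_Q_homog]);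
    iterating ([iterD_Q]) gives, for k > 0, Delta^k Q u = q^(2k) Q Delta^k u + c_k Delta^(k-1) u.
    The alpha_k are the solution of alpha_k q^(2k) + alpha_(k+1) c_(k+1) = 0 ([alpha_iter_coef]), so
    consecutive terms cancel, and the last remainder contains a Delta-power of [u] of negative
    degree ([sum_alpha_Q]).

    The passage rule is a computation on ordered monomials. Delta and multiplication by Q are both
    sums over the pairs (k, k'), one lowering and the other raising the two exponents ([lower_coef],
    [ordQ_ordmon]). Raising at l and lowering at k <> l give the same term in either order
    ([lower_raise_offdiag]), and the diagonal terms telescope over k ([diag_coefE],
    [sum_diag_coef]), which leaves a scalar depending on the degree alone. *)

(* [lia] does not treat iterated sums as atoms. *)
Ltac sum_lia :=
  repeat (let S := fresh "S" in set S := (bigop.body _ _ _); move: S => S); lia.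

(** * Exponent vectors: raising, lowering and partial degrees *)

Section Exponents.
Variable N : nat.
Implicit Types f : nat -> nat.

(** The involution j' for indices counted from 0. Indices and exponents are plain naturals here, so
    that inductions on an index carry no bound in their type. *)
Definition opp_index (k : nat) : nat := (N - k.+1)%N.
Local Notation r := opp_index.

Definition raise (k : nat) f (i : nat) : nat := (f i + (i == k) + (i == r k))%N.
Definition lower (k : nat) f (i : nat) : nat := (f i - (i == k) - (i == r k))%N.

Definition total_degree f : nat := (\sum_(0 <= i < N) f i)%N.

(** The d_j of the Laplacian, with j = k + 1. *)
Definition outer_degree (k : nat) f : nat :=
  (\sum_(0 <= i < k) f i + \sum_(N - k <= i < N) f i)%N.

Definition inner_degree (k : nat) f : nat := (\sum_(k.+1 <= i < r k) f i)%N.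

(** The condition under which the truncated subtractions in [lower] lose nothing. Where it fails,
    the coefficient of Delta is 0 ([lower_coef_eq0]). *)
Definition lowerable (k : nat) f : bool :=
  if (k < N./2)%N then (0 < f k)%N && (0 < f (r k))%N else (1 < f k)%N.

Lemma sum_nat_eq_const a b l :
  (\sum_(a <= i < b) (i == l :> nat) = (a <= l < b))%N.
Proof.
case: (leqP a b) => [ab|ba]; last first.
  by rewrite big_geq; [lia|exact: ltnW].
elim: b ab => [|b IH] ab; first by rewrite big_geq; lia.
case: (ltngtP a b.+1) ab => // [ab _|-> _]; last by rewrite big_geq; lia.
rewrite big_nat_recr //= IH; lia.
Qed.

Lemma sum_raise a b l f :
  (\sum_(a <= i < b) raise l f i
   = \sum_(a <= i < b) f i + (a <= l < b) + (a <= r l < b))%N.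
Proof. by rewrite !big_split /= !sum_nat_eq_const. Qed.

Lemma total_raise l f : (l < N)%N ->
  total_degree (raise l f) = (total_degree f + 2)%N.
Proof. by move=> lN; rewrite /total_degree sum_raise /r; sum_lia. Qed.

Lemma outer_raise k l f : (k < uphalf N)%N -> (l < uphalf N)%N ->
  outer_degree k (raise l f) = (outer_degree k f + (l < k)%N.*2)%N.
Proof.
move=> kN lN; rewrite /outer_degree !sum_raise /r.
have -> : (N - k <= l < N)%N = false by lia.
have -> : (0 <= N - l.+1 < k)%N = false by lia.
have -> : (N - k <= N - l.+1 < N)%N = (l < k)%N by lia.
rewrite leq0n /=; sum_lia.
Qed.

Lemma inner_raise k l f : (k < uphalf N)%N -> (l < uphalf N)%N ->
  inner_degree k (raise l f) = (inner_degree k f + (k < l)%N.*2)%N.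
Proof.
move=> kN lN; rewrite /inner_degree !sum_raise /r.
have -> : (k < N - l.+1 < N - k.+1)%N = (k < l)%N by lia.
have -> : (k < l < N - k.+1)%N = (k < l)%N by lia.
sum_lia.
Qed.

Lemma raise_id k l f : l != k -> l != r k -> raise k f l = f l.
Proof. by move=> /negPf lk /negPf lr; rewrite /raise lk lr !addn0. Qed.

Lemma raise_fst k f : (k < N./2)%N -> raise k f k = (f k).+1.
Proof.
move=> kn; rewrite /raise eqxx.
have -> : (k == r k) = false by rewrite /r; lia.
by rewrite addn0 addn1.
Qed.

Lemma raise_snd k f : (k < N./2)%N -> raise k f (r k) = (f (r k)).+1.
Proof.
move=> kn; rewrite /raise eqxx.
have -> : (r k == k) = false by rewrite /r; lia.
by rewrite addn0 addn1.
Qed.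

Lemma opp_mid : odd N -> r N./2 = N./2.
Proof. by rewrite /r; lia. Qed.

Lemma raise_mid f : odd N -> raise N./2 f N./2 = (f N./2).+2.
Proof. by move=> oN; rewrite /raise opp_mid // eqxx !addn1. Qed.

Lemma lower_raise k f : lower k (raise k f) =1 f.
Proof. by move=> i; rewrite /lower /raise; lia. Qed.

Lemma raise_lower k f : (k < uphalf N)%N -> lowerable k f ->
  raise k (lower k f) =1 f.
Proof.
move=> kN L i; rewrite /raise /lower.
suff: ((i == k) + (i == r k) <= f i)%N by case: (i == k); case: (i == _); lia.
move: L; rewrite /lowerable; case: ltnP => kn.
  have neq : k != r k by rewrite /r; lia.
  case/andP=> fk fr; case: (eqVneq i k) => [->|_]; first by rewrite (negPf neq).
  by case: (eqVneq i (r k)) => [->|_].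
have -> : r k = k by rewrite /r; lia.
by case: (eqVneq i k) => [->|_].
Qed.

Lemma lower_raiseC k l f : lower k (raise l (raise k f)) =1 raise l f.
Proof.
by move=> i; rewrite /lower /raise; case: (i == k); case: (i == r k); lia.
Qed.

Lemma outerS k f : (k < N./2)%N ->
  outer_degree k.+1 f = (outer_degree k f + f k + f (r k))%N.
Proof.
move=> kN; rewrite /outer_degree big_nat_recr //=.
rewrite [X in (_ + X = _)%N]big_ltn /r; last lia.
have -> : (N - k.+1).+1 = (N - k)%N by lia.
sum_lia.
Qed.

Lemma total_inner k f : (k < N./2)%N ->
  total_degree f = (outer_degree k.+1 f + inner_degree k f)%N.
Proof.
move=> kN; rewrite /total_degree /outer_degree /inner_degree /r.
rewrite (big_cat_nat _ (n := k.+1)) //=; last lia.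
rewrite [X in (_ + X = _)%N](big_cat_nat _ (n := (N - k.+1)%N)) //=; sum_lia.
Qed.

Lemma total_even f : ~~ odd N -> total_degree f = outer_degree N./2 f.
Proof.
move=> oN; rewrite /total_degree /outer_degree.
rewrite (big_cat_nat _ (n := N./2)) //=; last lia.
by have -> : (N - N./2 = N./2)%N by lia.
Qed.

Lemma total_odd f : odd N -> total_degree f = (outer_degree N./2 f + f N./2)%N.
Proof.
move=> oN; rewrite /total_degree /outer_degree.
rewrite (big_cat_nat _ (n := N./2)) //=; last lia.
rewrite [X in (_ + X = _)%N]big_ltn; last lia.
have -> : (N - N./2 = (N./2).+1)%N by lia.
sum_lia.
Qed.

Lemma inner_mid f : odd N -> inner_degree N./2 f = 0%N.
Proof. by move=> oN; rewrite /inner_degree big_geq // /r; lia. Qed.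

Lemma eq_total f g : f =1 g -> total_degree f = total_degree g.
Proof. by move=> fg; apply: eq_bigr. Qed.

Lemma eq_inner k f g : f =1 g -> inner_degree k f = inner_degree k g.
Proof. by move=> fg; apply: eq_bigr. Qed.

End Exponents.

(** * Normal ordering of Q times a monomial *)

Section NormalOrdering.
Variables (F : fieldType) (L : algType F) (N : nat) (q s : F) (y : nat -> L).
Hypothesis q_neq0 : q != 0.
Hypothesis s_sqr : s ^+ 2 = q.
Local Notation r := (opp_index N).
Local Notation n := N./2.

(* Twice rho_(j+1), for [j < n]. *)
Definition zrho (j : nat) : int := N%:Z - 2 - j.*2%:Z.

(* Twice rho at the index opposite to [j]. *)
Definition opp_rho2 (j : nat) : int :=
  if (j < n)%N then - zrho j
  else if odd N && (j == n) then 0 else j.*2%:Z - N%:Z.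

Definition rho_weight (j : nat) : F := s ^ zrho j + s ^ (- zrho j).

Definition partialQ (j : nat) : L :=
  \sum_(j <= k < N - j) s ^ opp_rho2 k *: (y k * y (r k)).

(** The factor s / (1 + q) is 1 / (s + s^-1), the inverse of the weight at the middle index of an
    odd [N]. *)
Definition core : L := if odd N then (s / (1 + q)) *: y n ^+ 2 else 0.

(* [partialQ j] in normal order, divided by [rho_weight j]. *)
Definition ordQ (j : nat) : L :=
  \sum_(j <= k < n) q ^+ (k - j) *: (y k * y (r k)) + q ^+ (n - j) *: core.

Definition ordmon (f : nat -> nat) : L := \prod_(0 <= i < N) y i ^+ f i.

Lemma eq_ordmon f g : f =1 g -> ordmon f = ordmon g.
Proof. by move=> fg; apply: eq_bigr => i _; rewrite fg. Qed.

Hypothesis weight_neq0 : forall j, (j <= n)%N -> rho_weight j != 0.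
Hypothesis y_qcomm : forall i j, (i < j < N)%N -> j != r i ->
  y i * y j = q *: (y j * y i).
Hypothesis y_conj : forall j, (j < n)%N ->
  y (r j) * y j - y j * y (r j)
  = ((q - q^-1) / rho_weight j.+1) *: partialQ j.+1.

Let s_neq0 : s != 0.
Proof. by move: q_neq0; rewrite -s_sqr expf_eq0. Qed.

Lemma ordQ_rec j : (j < n)%N -> ordQ j = y j * y (r j) + q *: ordQ j.+1.
Proof.
move=> jn; rewrite /ordQ big_ltn // subnn expr0 scale1r -addrA; congr (_ + _).
rewrite scalerDr scaler_sumr scalerA -exprS.
have -> : ((n - j.+1).+1 = n - j)%N by lia.
congr (_ + _); rewrite !big_nat; apply: eq_bigr => k /andP[jk _].
by rewrite scalerA -exprS; congr (_ ^+ _ *: _); lia.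
Qed.

Lemma ordQ_core : ordQ n = core.
Proof. by rewrite /ordQ big_geq // subnn expr0 scale1r add0r. Qed.

Lemma partialQ_rec j : (j < n)%N ->
  partialQ j = s ^ (- zrho j) *: (y j * y (r j)) + partialQ j.+1
               + s ^ zrho j *: (y (r j) * y j).
Proof.
move=> jn; rewrite /partialQ big_ltn; last lia.
have -> : (N - j = (r j).+1)%N by rewrite /r; lia.
rewrite big_nat_recr /=; last by rewrite /r; lia.
have -> : r (r j) = j by rewrite /r; lia.
rewrite {1}/opp_rho2 jn addrA; congr (_ + _ + _ *: _).
rewrite /opp_rho2 /zrho /r; case: ltnP => h; first lia.
case: ifP => [/andP[]|_]; first lia.
congr (s ^ _); lia.
Qed.

Lemma core_weight : partialQ n = rho_weight n *: core.
Proof.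
rewrite /partialQ /core /rho_weight /zrho; case: ifP => oN; last first.
  by rewrite big_geq ?scaler0 //; lia.
have -> : (N - n = n.+1)%N by lia.
have rn : r n = n by rewrite /r; lia.
rewrite big_nat1 /opp_rho2 ltnn oN eqxx /= expr0z scale1r rn scalerA.
have z1 : N%:Z - 2 - n.*2%:Z = -1 by lia.
have wE : rho_weight n = (1 + q) / s.
  by rewrite /rho_weight /zrho z1 opprK exprN1 expr1z -s_sqr; field.
have q1 : 1 + q != 0.
  by have := weight_neq0 (leqnn n); rewrite wE mulf_eq0 negb_or => /andP[].
move: wE; rewrite /rho_weight /zrho => ->.
have -> : (1 + q) / s * (s / (1 + q)) = 1 by field; rewrite q1 s_neq0.
by rewrite scale1r.
Qed.

(** Peeling off the outer pair and reordering [y (r j) * y j] gives w_j y_j y_j' + (w_(j+1) +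
    s^(zrho j) (q - q^-1)) P_(j+1), and the bracket equals q w_j. The induction descends from the
    middle, where the claim is [core_weight]. *)
Lemma partialQE j : (j <= n)%N -> partialQ j = rho_weight j *: ordQ j.
Proof.
move=> jn; rewrite -(subKn jn); elim: (n - j)%N (leq_subr j n) => [|d IH] dn.
  by rewrite subn0 ordQ_core core_weight.
have jlt : (n - d.+1 < n)%N by lia.
move: (IH (ltnW dn)); have -> : (n - d = (n - d.+1).+1)%N by lia.
set i := (n - d.+1)%N in jlt * => {}IH.
have w0 := weight_neq0 jlt.
have zS : zrho i.+1 = zrho i - 2 by rewrite /zrho; lia.
have := y_conj jlt; rewrite IH scalerA divfK // => /eqP.
rewrite subr_eq => /eqP yc.
rewrite partialQ_rec // IH yc (ordQ_rec jlt).
have -> : rho_weight i.+1 = rho_weight i * q - s ^ zrho i * (q - q^-1).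
  have s2 : s ^ (2 : int) = q by rewrite -s_sqr.
  rewrite /rho_weight zS opprB; move: (zrho i) => z.
  rewrite (expfzDr z (- 2)) // (expfzDr 2 (- z)) // -!invr_expz s2.
  by field; rewrite q_neq0 expfz_neq0.
move: (ordQ _) (y i * _) => O X.
rewrite !scalerDr scalerBl !scalerA addrA -[_ + _ + (_ * _) *: O]addrA subrK.
by rewrite addrAC -scalerDl [X in X *: _]addrC.
Qed.

Lemma y_opp_conj j : (j < n)%N ->
  y (r j) * y j = y j * y (r j) + (q - q^-1) *: ordQ j.+1.
Proof.
move=> jn; have := y_conj jn.
rewrite (partialQE jn) scalerA divfK ?weight_neq0 //.
by move/eqP; rewrite subr_eq addrC => /eqP.
Qed.

Lemma y_qcommV i j : (i < j < N)%N -> j != r i ->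
  y j * y i = q^-1 *: (y i * y j).
Proof. by move=> ij jr; rewrite (y_qcomm ij jr) scalerA mulVf // scale1r. Qed.

Lemma core_y i : (i < n)%N -> core * y i = q^-2 *: (y i * core).
Proof.
move=> iN; rewrite /core; case: ifP => oN; last by rewrite mul0r mulr0 scaler0.
have c : y n * y i = q^-1 *: (y i * y n) by rewrite y_qcommV // /r; lia.
rewrite -scalerAl -scalerAr scalerA [q^-2 * _]mulrC -(scalerA (s / _)).
congr (_ *: _); rewrite (expr2 (y n)) -mulrA c -scalerAr mulrA c -scalerAl.
rewrite scalerA -mulrA.
by rewrite expr2 invfM.
Qed.

(** All indices in P_j lie strictly between i and i', so each of the two factors of every term
    q-commutes with [y i] and contributes one q^-1. *)
Lemma ordQ_y i j : (i < j <= n)%N -> ordQ j * y i = q^-2 *: (y i * ordQ j).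
Proof.
move=> /andP[ij jn]; rewrite /ordQ mulrDl mulrDr scalerDr mulr_suml mulr_sumr.
rewrite -scalerAl core_y; last exact: leq_trans jn.
rewrite -scalerAr !scalerA [q^-2 * _]mulrC; congr (_ + _).
rewrite scaler_sumr !big_nat; apply: eq_bigr => k /andP[jk kn].
rewrite -scalerAl -scalerAr scalerA [q^-2 * _]mulrC -(scalerA (q ^+ _)).
congr (_ *: _).
have ck : y k * y i = q^-1 *: (y i * y k) by rewrite y_qcommV // /r; lia.
have cr : y (r k) * y i = q^-1 *: (y i * y (r k)).
  by rewrite y_qcommV // /r; lia.
by rewrite -mulrA cr -scalerAr mulrA ck -scalerAl scalerA mulrA expr2 invfM.
Qed.

(* The two terms produced by [y_opp_conj] and [ordQ_y] recombine since        *)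
(* (q - q^-1) + q * q^-2 = q.                                                 *)
Lemma ordQ_comm j : (j < n)%N -> ordQ j * y j = y j * ordQ j.
Proof.
move=> jn; rewrite (ordQ_rec jn) mulrDl mulrDr -mulrA y_opp_conj // mulrDr.
rewrite mulrA.
rewrite -scalerAl ordQ_y ?leqnn // -!scalerAr scalerA -addrA -scalerDl.
by rewrite -expr2; congr (_ + _ *: _); field.
Qed.

Lemma ordQ_commX j e : (j < n)%N -> ordQ j * y j ^+ e = y j ^+ e * ordQ j.
Proof. by move=> jn; apply: commrX; apply: ordQ_comm. Qed.

(** The only index not q-commuting with j' is j, which lies outside the range; every factor crossed
    costs one q^-1. *)
Lemma y_opp_pass j f b : (j < n)%N -> (j < b <= r j)%N ->
  y (r j) * \prod_(j.+1 <= i < b) y i ^+ f i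
  = (q ^+ (\sum_(j.+1 <= i < b) f i))^-1 *:
      (\prod_(j.+1 <= i < b) y i ^+ f i * y (r j)).
Proof.
move=> jn; elim: b => [|b IH]; first by rewrite ltn0.
case/andP; rewrite ltnS leq_eqVlt => /orP[/eqP <- _|jb bj].
  by rewrite !big_geq // expr0 invr1 scale1r mul1r mulr1.
rewrite !(big_nat_recr b) //= mulrA IH; last by rewrite jb ltnW.
have pass e : y (r j) * y b ^+ e = q ^- e *: (y b ^+ e * y (r j)).
  elim: e => [|e IHe]; first by rewrite expr0 invr1 scale1r mul1r mulr1.
  rewrite exprS mulrA y_qcommV; last by rewrite /r; lia.
    rewrite -scalerAl -(mulrA _ (y (r j))) IHe -scalerAr scalerA mulrA.
    by rewrite (exprS q) invfM.
  by move: bj; rewrite /r; lia.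
rewrite -scalerAl -(mulrA _ (y (r j))) pass -scalerAr scalerA mulrA.
by rewrite exprD invfM.
Qed.

Lemma ordmon_split j f : (j < n)%N ->
  ordmon f = \prod_(0 <= i < j) y i ^+ f i *
    (y j ^+ f j * (\prod_(j.+1 <= i < r j) y i ^+ f i *
      (y (r j) ^+ f (r j) * \prod_((r j).+1 <= i < N) y i ^+ f i))).
Proof.
move=> jn; rewrite /ordmon (big_cat_nat _ (n := j)) //=; last lia.
rewrite (big_ltn (m := j)); last lia.
rewrite (big_cat_nat _ (m := j.+1) (n := r j)) /=; try by rewrite /r; lia.
by rewrite (big_ltn (m := r j)) // /r; lia.
Qed.

(* For odd N the index k = N./2 is the middle one, where [inner_degree] is 0. *)
Definition raise_coef (k : nat) (f : nat -> nat) : F :=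
  q ^+ k * (if (k < n)%N then 1 else s / (1 + q)) / q ^+ inner_degree N k f.

(** Of the new pair, [y j] joins its own power at once, while [y (r j)] has to cross the inner
    variables; this is the division by q^inner_degree. *)
Lemma ordmon_raise j f : (j < n)%N ->
  q ^+ j *: (\prod_(0 <= i < j) y i ^+ f i *
    (y j ^+ f j * (y j * y (r j) * \prod_(j.+1 <= i < N) y i ^+ f i)))
  = raise_coef j f *: ordmon (raise N j f).
Proof.
move=> jn; rewrite (ordmon_split _ jn) /raise_coef jn mulr1.
rewrite (big_cat_nat _ (m := j.+1) (n := r j)) /=; try by rewrite /r; lia.
rewrite (big_ltn (m := r j)); last by rewrite /r; lia.
have E a b : ~~ (a <= j < b)%N -> ~~ (a <= r j < b)%N ->
    \prod_(a <= i < b) y i ^+ raise N j f i = \prod_(a <= i < b) y i ^+ f i.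
  move=> ja ra; apply: eq_big_nat => i iab; rewrite raise_id //.
    by apply: contraNneq ja => <-.
  by apply: contraNneq ra => <-.
rewrite !E; try by rewrite /r; lia.
rewrite raise_fst // raise_snd //.
rewrite -[in LHS]mulrA (mulrA (y (r j))) y_opp_pass //; last by rewrite /r; lia.
rewrite /inner_degree -!(scalerAl, scalerAr) scalerA; congr (_ *: (_ * _)).
by rewrite exprSr exprS -!mulrA.
Qed.

Lemma ordQ_ordmon f :
  ordQ 0 * ordmon f
  = \sum_(0 <= k < uphalf N) raise_coef k f *: ordmon (raise N k f).
Proof.
(* Invariant: P_j stands just before y_j. It commutes with the power of y_j and splits there as y_j
   y_j' + q P_(j+1); the first part yields the monomial raised at j, the second moves on. *)
have H j : (j <= n)%N -> ordQ 0 * ordmon f =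
    \sum_(0 <= k < j) raise_coef k f *: ordmon (raise N k f)
    + q ^+ j *: (\prod_(0 <= i < j) y i ^+ f i *
                 (ordQ j * \prod_(j <= i < N) y i ^+ f i)).
  elim: j => [_|j IH jn].
    by rewrite !(big_geq (leqnn 0)) expr0 scale1r mul1r add0r.
  rewrite (IH (ltnW jn)) !(big_nat_recr j) //= -addrA; congr (_ + _).
  rewrite (big_ltn (m := j)); last lia.
  rewrite (mulrA (ordQ j)) ordQ_commX // -(mulrA (y j ^+ _)) (ordQ_rec jn).
  rewrite mulrDl !mulrDr scalerDr ordmon_raise //; congr (_ + _).
  by rewrite -!(scalerAl, scalerAr) scalerA -exprSr mulrA.
rewrite (H n) // ordQ_core /core; case: ifP => oN; last first.
  have -> : uphalf N = n by lia.
  by rewrite mul0r mulr0 scaler0 addr0.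
have -> : uphalf N = n.+1 by lia.
rewrite big_nat_recr //=; congr (_ + _).
rewrite /raise_coef ltnn inner_mid // expr0 divr1.
rewrite -!(scalerAl, scalerAr) scalerA; congr (_ *: _).
rewrite /ordmon (big_cat_nat _ (m := 0%N) (n := n) (p := N)) //=; last lia.
rewrite (big_ltn (m := n)); last lia.
rewrite [in RHS](big_ltn (m := n)); last lia.
rewrite (mulrA (y n ^+ 2)) -exprD; congr (_ * (_ ^+ _ * _)).
- apply: eq_big_nat => i /andP[_ iN].
  by rewrite raise_id // ?opp_mid // neq_ltn iN.
- by rewrite raise_mid.
- apply: eq_big_nat => i /andP[ni _].
  by rewrite raise_id // ?opp_mid // neq_ltn ni orbT.
Qed.

End NormalOrdering.

(** * Commutation of Delta with multiplication by Q *)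

Section Commutation.
Variables (F : fieldType) (L : algType F) (N : nat) (q s : F) (y : nat -> L).
Hypothesis q_neq0 : q != 0.
Hypothesis q_nroot : forall k, (0 < k)%N -> q ^+ k != 1.
Hypothesis s_sqr : s ^+ 2 = q.
Local Notation r := (opp_index N).
Local Notation n := N./2.
Local Notation rc := (raise_coef N q s).

(* The coefficients of Delta on ordered monomials, up to the factor           *)
(* (1 + q^(N-2)) q^(|f|-1); for odd N the index k = N./2 is the middle one.   *)
Definition lower_coef (k : nat) (f : nat -> nat) : F :=
  (if (k < n)%N then
     (q ^+ f k - q ^- f k) / (q - q^-1)
     * ((q ^+ f (r k) - q ^- f (r k)) / (q - q^-1)) * (q ^+ k.+1 / s ^+ N)
   else
     (1 - q ^+ f k / q) * (1 - q ^+ f k) / (1 - q) ^+ 2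
     * (q ^+ 2 / q ^+ f k / (1 + q))) * q ^+ outer_degree N k f.

Local Notation lc := lower_coef.

Let s_neq0 : s != 0.
Proof. by move: q_neq0; rewrite -s_sqr expf_eq0. Qed.

Let q1_neq0 : 1 - q != 0.
Proof. by rewrite subr_eq0 eq_sym -[q]expr1 q_nroot. Qed.

Let q2_neq0 : 1 - q ^+ 2 != 0.
Proof. by rewrite subr_eq0 eq_sym q_nroot. Qed.

Let q1p_neq0 : 1 + q != 0.
Proof.
move: q2_neq0; rewrite -[X in X - _](expr1n _ 2) subr_sqr mulf_eq0 negb_or.
by case/andP.
Qed.

Let qq_neq0 : q ^+ 2 - 1 != 0.
Proof. by rewrite subr_eq0 q_nroot. Qed.

Lemma eq_raise_coef k f g : f =1 g -> rc k f = rc k g.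
Proof. by move=> fg; rewrite /raise_coef (eq_inner _ _ fg). Qed.

Lemma lower_coef_eq0 k f : (k < uphalf N)%N -> ~~ lowerable N k f -> lc k f = 0.
Proof.
rewrite /lowerable /lower_coef => kN; case: ifP => _.
  rewrite negb_and !lt0n !negbK => /orP[] /eqP ->;
  by rewrite expr0 invr1 subrr mul0r ?(mul0r, mulr0).
case: (f k) => [|[|e]] // _; first by rewrite expr0 subrr mulr0 !mul0r.
by rewrite expr1 divff // subrr !mul0r.
Qed.

Lemma lower_coef_raise k l f : (k < uphalf N)%N -> (l < uphalf N)%N -> k != l ->
  lc k (raise N l f) = q ^+ (l < k)%N.*2 * lc k f.
Proof.
move=> kN lN kl; rewrite /lower_coef outer_raise // exprD.
have -> : raise N l f k = f k by rewrite raise_id //; rewrite /r; lia.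
rewrite [RHS]mulrC -[RHS]mulrA; congr (_ * _); case: ifP => // kn.
by have -> : raise N l f (r k) = f (r k) by rewrite raise_id /r; lia.
Qed.

Lemma raise_coef_raise k l f : (k < uphalf N)%N -> (l < uphalf N)%N ->
  rc l (raise N k f) = rc l f / q ^+ (l < k)%N.*2.
Proof.
by move=> kN lN; rewrite /raise_coef inner_raise // exprD invfM mulrA.
Qed.

(** A raise at l multiplies the lowering coefficient at k by q^2 exactly when l < k, because it
    enlarges the outer degree of k; a lowering at k multiplies the raising coefficient at l by the
    same power, because it shrinks the inner degree of l. If [f] cannot be lowered at k, both sides
    vanish. *)
Lemma lower_raise_offdiag k l f :
  (k < uphalf N)%N -> (l < uphalf N)%N -> k != l ->
  (rc l f * lc k (raise N l f)) *: ordmon N y (lower N k (raise N l f))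
  = (lc k f * rc l (lower N k f)) *: ordmon N y (raise N l (lower N k f)).
Proof.
move=> kN lN kl; rewrite lower_coef_raise //.
case: (boolP (lowerable N k f)) => [fk|/(lower_coef_eq0 kN) ->]; last first.
  by rewrite mulr0 mulr0 mul0r !scale0r.
set g := lower N k f; have fE := raise_lower kN fk; rewrite -/g in fE.
rewrite -(eq_raise_coef l fE) raise_coef_raise // mulrA divfK ?expf_neq0 //.
rewrite mulrC.
congr (_ *: _); apply: eq_ordmon => i; rewrite -(lower_raiseC N k l g i).
by rewrite /lower /raise -fE.
Qed.

Lemma raise_lower_diag k f : (k < uphalf N)%N ->
  (lc k f * rc k (lower N k f)) *: ordmon N y (raise N k (lower N k f))
  = (lc k f * rc k f) *: ordmon N y f.
Proof.
move=> kN.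
case: (boolP (lowerable N k f)) => [fk|/(lower_coef_eq0 kN) ->]; last first.
  by rewrite !mul0r !scale0r.
have fE := raise_lower kN fk; rewrite (eq_ordmon _ _ fE).
by rewrite -[in RHS](eq_raise_coef k fE) raise_coef_raise // ltnn expr0 divr1.
Qed.

Definition diag_coef k f : F := rc k f * (lc k (raise N k f) - lc k f).

Let diag_sum k f : F :=
  (q ^+ k) ^+ 2 * (q ^+ outer_degree N k f) ^+ 2
    / (s ^+ N * q ^+ total_degree N f * (q - q^-1)).

(** With a, b the exponents at k and k', this rests on [a+1][b+1] - [a][b] = [a+b+1] for the
    symmetric q-numbers; the two powers of q in [a+b+1] become the two values of [diag_sum]. *)
Lemma diag_coefE k f : (k < n)%N ->
  diag_coef k f = diag_sum k.+1 f - diag_sum k f.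
Proof.
move=> kn; rewrite /diag_coef /diag_sum /raise_coef /lower_coef kn.
rewrite outer_raise ?ltnn ?addn0; try lia.
rewrite raise_fst // raise_snd // (total_inner f kn) (outerS f kn).
rewrite !exprD !exprS.
by field; rewrite -expr2 qq_neq0 !expf_neq0 ?q_neq0.
Qed.

Definition diag_total (m : nat) : F :=
  (q ^+ N * (q ^+ m) ^+ 2 - 1) / (s ^+ N * q ^+ m * (q - q^-1)).

Lemma sum_diag_coef f :
  \sum_(k < uphalf N) diag_coef k f = diag_total (total_degree N f).
Proof.
rewrite -(big_mkord xpredT (fun k => diag_coef k f)).
have H : \sum_(0 <= k < n) diag_coef k f = diag_sum n f - diag_sum 0 f.
  rewrite -(telescope_sumr (fun k => diag_sum k f)) // !big_nat.
  by apply: eq_bigr => k kn; apply: diag_coefE.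
have E0 : diag_sum 0 f = 1 / (s ^+ N * q ^+ total_degree N f * (q - q^-1)).
  by rewrite /diag_sum /outer_degree subn0 !big_geq // expr0 expr1n mulr1.
case: (boolP (odd N)) => oN; last first.
  have -> : uphalf N = n by lia.
  rewrite H E0 /diag_sum /diag_total -total_even // -mulrBl -exprM.
  by have -> : (n * 2 = N)%N by lia.
(* For odd [N] the middle index adds one term beyond the telescoping range; it makes up the
   difference between [diag_sum n f] and the value with the total degree. *)
have -> : uphalf N = n.+1 by lia.
rewrite big_nat_recr //= H E0 /diag_coef /raise_coef /lower_coef ltnn.
rewrite inner_mid // outer_raise ?ltnn ?addn0; try lia.
rewrite raise_mid // /diag_sum /diag_total total_odd // exprD.
have -> : s ^+ N = q ^+ n * s.
  by rewrite -s_sqr -exprM -exprSr; congr (_ ^+ _); lia.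
have -> : q ^+ N = q ^+ n * q ^+ n * q.
  by rewrite -exprD -exprSr; congr (_ ^+ _); lia.
have -> : s / (1 + q) = q / (s * (1 + q)).
  by rewrite -{2}s_sqr; field; rewrite q1p_neq0 s_neq0.
rewrite !exprS expr0.
field; rewrite -expr2 qq_neq0 s_neq0 q1p_neq0 q1_neq0 oner_neq0 !expf_neq0 //.
by rewrite q_neq0.
Qed.

Lemma raise_lower_commutator f :
  \sum_(l < uphalf N) rc l f *:
      (\sum_(k < uphalf N)
        lc k (raise N l f) *: ordmon N y (lower N k (raise N l f)))
  = \sum_(k < uphalf N) lc k f *:
      (\sum_(l < uphalf N)
        rc l (lower N k f) *: ordmon N y (raise N l (lower N k f)))
    + diag_total (total_degree N f) *: ordmon N y f.
Proof.
under eq_bigr do rewrite scaler_sumr.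
rewrite exchange_big /= -sum_diag_coef scaler_suml -big_split /=.
apply: eq_bigr => k _; rewrite scaler_sumr (bigD1 k) //= [in RHS](bigD1 k) //=.
rewrite addrAC; congr (_ + _); last first.
  apply: eq_bigr => l lk; rewrite !scalerA lower_raise_offdiag //.
  by rewrite eq_sym.
rewrite !scalerA raise_lower_diag // (eq_ordmon _ _ (lower_raise N k f)).
by rewrite -scalerDl /diag_coef mulrBr (mulrC (rc k f) (lc k f)) addrC subrK.
Qed.

Variable D : {linear L -> L}.
Hypothesis D_ordmon : forall f, D (ordmon N y f) =
  ((1 + q ^+ (N - 2)) * q ^ ((total_degree N f)%:Z - 1)) *:
    (\sum_(k < uphalf N) lc k f *: ordmon N y (lower N k f)).
Variable Q : L.
Hypothesis Q_ordmon : forall f, Q * ordmon N y f =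
  ((1 + q ^+ (N - 2)) * q / s ^+ N) *:
    (\sum_(l < uphalf N) rc l f *: ordmon N y (raise N l f)).

(** The factor q^2 comes from the prefactor q^(degree - 1) of Delta, evaluated two degrees higher
    after multiplication by Q; the scalar is [diag_total] times the prefactors. *)
Lemma D_Q_ordmon f :
  D (Q * ordmon N y f) = q ^+ 2 *: (Q * D (ordmon N y f))
    + ((1 + q ^+ (N - 2)) ^+ 2 * q ^ (3 - N%:Z)
       * (1 - q ^ (N%:Z + (total_degree N f).*2%:Z)) / (1 - q ^+ 2))
      *: ordmon N y f.
Proof.
set kappa := 1 + q ^+ (N - 2); set m := total_degree N f.
have qz a : q ^ (a%:Z - 1) = q ^+ a / q by rewrite expfzDr.
rewrite Q_ordmon linearZ linear_sum /=.
have -> : \sum_(l < uphalf N) D (rc l f *: ordmon N y (raise N l f))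
    = (kappa * (q ^+ m * q)) *: \sum_(l < uphalf N) rc l f *:
      (\sum_(k < uphalf N)
        lc k (raise N l f) *: ordmon N y (lower N k (raise N l f))).
  rewrite scaler_sumr; apply: eq_bigr => l _.
  rewrite linearZ /= D_ordmon total_raise; last by have := ltn_ord l; lia.
  rewrite -/m qz exprD !scalerA; congr (_ *: _); rewrite /kappa.
  by move: (rc l f) => c; field.
rewrite raise_lower_commutator D_ordmon -/m qz -scalerAr mulr_sumr.
have -> : \sum_(k < uphalf N) Q * (lc k f *: ordmon N y (lower N k f))
    = (kappa * q / s ^+ N) *: \sum_(k < uphalf N) lc k f *:
      (\sum_(l < uphalf N)
        rc l (lower N k f) *: ordmon N y (raise N l (lower N k f))).
  rewrite scaler_sumr; apply: eq_bigr => k _.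
  by rewrite -scalerAr Q_ordmon !scalerA mulrC.
rewrite -/kappa !scalerDr !scalerA; congr (_ *: _ + _ *: _).
  by rewrite mulrC; field; rewrite q_neq0 expf_neq0.
rewrite /diag_total -/m expfzDr // expfzDr // -[q ^ (- N%:Z)]invr_expz.
have -> : q ^ (m.*2%:Z) = (q ^+ m) ^+ 2 by rewrite -exprM muln2.
have -> : q ^ (3 : int) = q ^+ 3 by [].
have -> : q ^ N%:Z = s ^+ N * s ^+ N.
  by rewrite -exprnP -s_sqr -exprM mul2n -addnn exprD.
have -> : q ^+ N = s ^+ N * s ^+ N by rewrite -s_sqr -exprM mul2n -addnn exprD.
by field; rewrite -expr2 q_neq0 q2_neq0 qq_neq0 !expf_neq0.
Qed.

Inductive homog (m : int) : L -> Prop :=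
| homog0 : homog m 0
| homog_cons c f p : (total_degree N f)%:Z = m -> homog m p ->
    homog m (c *: ordmon N y f + p).

Lemma homogD m u v : homog m u -> homog m v -> homog m (u + v).
Proof.
move=> hu hv; elim: hu => [|c f p fm _ IH];
  by rewrite ?add0r // -addrA; constructor.
Qed.

Lemma homogZ m a u : homog m u -> homog m (a *: u).
Proof.
elim=> [|c f p fm _ IH]; first by rewrite scaler0; constructor.
by rewrite scalerDr scalerA; constructor.
Qed.

Lemma homog_ordmon f : homog (total_degree N f) (ordmon N y f).
Proof. by rewrite -[ordmon N y f]scale1r -[_ *: _]addr0; do 2!constructor. Qed.

Lemma homog_lt0 m p : m < 0 -> homog m p -> p = 0.
Proof. by move=> m0; case=> // c f u fm; move: m0; rewrite -fm. Qed.

Lemma homog_D m p : homog m p -> homog (m - 2) (D p).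
Proof.
elim=> [|c f u fm _ IH]; first by rewrite linear0; constructor.
rewrite linearD linearZ /=; apply: homogD => //; apply: homogZ.
rewrite D_ordmon; apply: homogZ.
elim/big_ind: _ => [|a b ha hb|k _]; [by constructor|exact: homogD|].
case: (boolP (lowerable N k f))
  => [fk|/(lower_coef_eq0 (ltn_ord k)) ->]; last first.
  by rewrite scale0r; constructor.
apply: homogZ; suff -> : m - 2 = total_degree N (lower N k f).
  exact: homog_ordmon.
have kN : (k < N)%N by have := ltn_ord k; lia.
rewrite -fm -(eq_total N (raise_lower (ltn_ord k) fk)) total_raise //; lia.
Qed.

Lemma D_Q_homog m p : homog m p ->
  D (Q * p) = q ^+ 2 *: (Q * D p)
    + ((1 + q ^+ (N - 2)) ^+ 2 * q ^ (3 - N%:Z)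
       * (1 - q ^ (N%:Z + 2 * m))
     / (1 - q ^+ 2)) *: p.
Proof.
elim=> [|c f u fm _ IH].
  by rewrite mulr0 !linear0 mulr0 !scaler0 addr0.
rewrite mulrDr !(linearD D) IH -scalerAr !(linearZ_LR D) D_Q_ordmon.
have -> : (total_degree N f).*2%:Z = 2 * m by lia.
rewrite (mulrDr Q) !scalerDr -scalerAr !scalerA addrACA.
by congr (_ *: _ + _ + (_ *: _ + _)); rewrite mulrC.
Qed.

End Commutation.

(** * Iterating the commutation rule and telescoping the alternating sum *)

Section Projector.
Variables (F : fieldType) (L : algType F) (N : nat) (q : F) (Q : L).
Variables (D : {linear L -> L}) (hom : int -> L -> Prop).
Hypothesis q_neq0 : q != 0.
Hypothesis q_nroot : forall k, (0 < k)%N -> q ^+ k != 1.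
Hypothesis kappa_neq0 : 1 + q ^+ (N - 2) != 0.
Local Notation kappa := (1 + q ^+ (N - 2)).
Hypothesis hom_D : forall m p, hom m p -> hom (m - 2) (D p).
Hypothesis hom_neg : forall (m : int) p, m < 0 -> hom m p -> p = 0.
Hypothesis D_Q : forall m p, hom m p -> D (Q * p) = q ^+ 2 *: (Q * D p)
  + (kappa ^+ 2 * q ^ (3 - N%:Z) * (1 - q ^ (N%:Z + 2 * m))
     / (1 - q ^+ 2)) *: p.

Let q2_neq0 : 1 - q ^+ 2 != 0.
Proof. by rewrite subr_eq0 eq_sym q_nroot. Qed.

Lemma hom_iterD k m p : hom m p -> hom (m - 2 * k%:Z) (iter k D p).
Proof.
move=> hp; elim: k => [|k IH]; first by rewrite mulr0 subr0.
have -> : m - 2 * k.+1%:Z = m - 2 * k%:Z - 2 by lia.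
exact: hom_D.
Qed.

Lemma iterDD k u v : iter k D (u + v) = iter k D u + iter k D v.
Proof. by elim: k => //= k ->; rewrite linearD. Qed.

Lemma iterD0 k : iter k D 0 = 0.
Proof. by elim: k => //= k ->; rewrite linear0. Qed.

(** The sum over i < k of q^(2i) times the scalar of [D_Q] in degree m - 2i, in closed form. *)
Definition iter_coef (m : int) (k : nat) : F :=
  kappa ^+ 2 * q ^ (3 - N%:Z) * (1 - q ^+ k.*2)
    * (1 - q ^ (N%:Z + 2 * m - k.*2%:Z + 2)) / (1 - q ^+ 2) ^+ 2.

Lemma iterD_Q m p k : hom m p ->
  iter k.+1 D (Q * p) = q ^+ k.+1.*2 *: (Q * iter k.+1 D p)
    + iter_coef m k.+1 *: iter k D p.
Proof.
move=> hp; elim: k => [|k IH].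
  rewrite /= (D_Q hp); congr (_ + _ *: _); rewrite /iter_coef.
  have -> : N%:Z + 2 * m - 1.*2%:Z + 2 = N%:Z + 2 * m by lia.
  by rewrite doubleS; move: (q ^ _) (q ^ _) => a b; field.
rewrite [LHS]iterS IH linearD !linearZ_LR (D_Q (hom_iterD k.+1 hp)).
rewrite scalerDr !scalerA -addrA -scalerDl -exprD !doubleS addn2.
congr (_ + _ *: _); rewrite /iter_coef !doubleS.
(* Every power of q is expressed through [W] and q^(2k+2), which leaves a rational identity for
   [field]. *)
set W := q ^ (N%:Z + 2 * m).
have -> : q ^ (N%:Z + 2 * (m - 2 * k.+1%:Z)) = W / (q ^+ k.*2.+2) ^+ 2.
  rewrite -exprM [q ^- _]exprnN -expfzDr //; congr (q ^ _); lia.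
have -> : q ^ (N%:Z + 2 * m - k.*2.+2%:Z + 2) = W * q ^+ 2 / q ^+ k.*2.+2.
  rewrite [q ^- _]exprnN [q ^+ 2]exprnP -!expfzDr //; congr (q ^ _); lia.
have -> : q ^ (N%:Z + 2 * m - k.*2.+4%:Z + 2) = W / q ^+ k.*2.+2.
  rewrite [q ^- _]exprnN -expfzDr //; congr (q ^ _); lia.
rewrite !(exprS q k.*2.+3) !(exprS q k.*2.+2).
have : q ^+ k.*2.+2 != 0 by rewrite expf_neq0.
move: (q ^+ k.*2.+2) => X X0.
by move: (q ^ _) W => c W; field; rewrite q2_neq0 X0.
Qed.

Lemma alpha0 M : alpha N q M 0 = 1.
Proof.
rewrite /alpha /qpoch !big_ord0 !muln0 !expr0 !mulr1 invr1 mulr1.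
by have -> : 2 * 0%:Z ^+ 2 - 2 * M%:Z * 0%:Z - 0%:Z = 0 by ring.
Qed.

Hypothesis N_gt0 : (0 < N)%N.

(** The new Pochhammer factor 1 - W^-1 of alpha_(k+1) meets the factor 1 - W of [iter_coef]; their
    quotient -W supplies the sign. The bound on k keeps all exponents in the first Pochhammer symbol
    negative, so no denominator vanishes. *)
Lemma alpha_iter_coef M k : (k.+1 <= M./2)%N ->
  alpha N q M k * q ^+ k.*2 + alpha N q M k.+1 * iter_coef (M%:Z - 2) k.+1 = 0.
Proof.
move=> kM; rewrite /alpha /qpoch !big_ord_recr /=.
have nz (e : int) : (e != 0) -> 1 - q ^ e != 0.
  move=> e0; rewrite subr_eq0 eq_sym; case: e e0 => [[|e]|e] // _.
    by rewrite -exprnP q_nroot.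
  by rewrite NegzE -exprnN invr_eq1 q_nroot.
set W := q ^ (N%:Z + 2 * (M%:Z - 2) - k.*2%:Z).
set A1 := \prod_(i < k) _; set A2 := \prod_(i < k) _.
have A1_neq0 : A1 != 0.
  apply/prodf_neq0 => i _; rewrite -exprM exprnP -expfzDr // nz //.
  have := ltn_ord i; lia.
have A2_neq0 : A2 != 0.
  by apply/prodf_neq0 => i _; rewrite -exprM -exprD exprnP nz //; lia.
have -> : (1 - q ^ (- N%:Z - 2 * M%:Z + 4) * q ^+ 2 ^+ k) = 1 - W^-1.
  rewrite -exprM exprnP -expfzDr // invr_expz; congr (1 - q ^ _); lia.
rewrite /iter_coef doubleS.
have -> : q ^ (N%:Z + 2 * (M%:Z - 2) - k.*2.+2%:Z + 2) = W.
  congr (q ^ _); lia.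
have -> : q ^+ 2 ^+ k = q ^+ k.*2 by rewrite -exprM mul2n.
have -> : q ^+ k.*2.+2 = q ^+ 2 * q ^+ k.*2 by rewrite -exprD.
rewrite !mulnS !(exprD _ 2 (2 * k)); set X := q ^+ k.*2.
have X_neq0 : X != 0 by rewrite expf_neq0.
have W_neq0 : W != 0 by rewrite expfz_neq0.
set c := q ^ (3 - N%:Z).
have c_neq0 : c != 0 by rewrite expfz_neq0.
have -> : q ^ (2 * k.+1%:Z ^+ 2 - 2 * M%:Z * k.+1%:Z - k.+1%:Z)
    = q ^ (2 * k%:Z ^+ 2 - 2 * M%:Z * k%:Z - k%:Z) * X / (W * c).
  rewrite /X /W /c -(expfzDr (N%:Z + _ - _)) // invr_expz (exprnP q k.*2).
  rewrite -(expfzDr _ k.*2%:Z) // -expfzDr //; congr (q ^ _).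
  have -> : k.+1%:Z = k%:Z + 1 by lia.
  have -> : k.*2%:Z = 2 * k%:Z by lia.
  ring.
have W1 : W - 1 != 0 by rewrite -opprB oppr_eq0 nz //; lia.
have X1 : 1 - q ^+ 2 * X != 0 by rewrite -exprD exprnP nz //; lia.
have := expf_neq0 (2 * k) kappa_neq0; have := expf_neq0 (2 * k) q2_neq0.
have := expf_neq0 2 kappa_neq0; move: q2_neq0 X1.
move: (kappa ^+ (2 * k)) ((1 - q ^+ 2) ^+ (2 * k)) (q ^ (_ - _ - _)).
move: (1 - q ^+ 2) (1 - q ^+ 2 * X) (kappa ^+ 2) => d e K.
move: W W_neq0 W1 c c_neq0 => W W_neq0 W1 c c_neq0 Kk dk E.
move=> d_neq0 e_neq0 K_neq0 dk_neq0 Kk_neq0.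
field.
by rewrite W_neq0 c_neq0 W1 A1_neq0 A2_neq0 d_neq0 e_neq0 K_neq0 Kk_neq0.
Qed.

Lemma sum_alpha_Q M p : hom (M%:Z - 2) p ->
  \sum_(k < (M./2).+1) alpha N q M k *: (Q ^+ k * iter k D (Q * p)) = 0.
Proof.
move=> hp.
(* In a partial sum everything cancels except the part of its last term in which Delta has passed
   Q. *)
have H j : (j <= M./2)%N ->
    \sum_(0 <= k < j.+1) alpha N q M k *: (Q ^+ k * iter k D (Q * p))
    = (alpha N q M j * q ^+ j.*2) *: (Q ^+ j.+1 * iter j D p).
  elim: j => [|j IH] jM.
    by rewrite big_nat1 alpha0 expr0 mul1r mulr1 expr1 scale1r.
  rewrite big_nat_recr // (IH (ltnW jM)) (iterD_Q _ hp) /=.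
  rewrite mulrDr -!scalerAr scalerDr !scalerA (mulrA (Q ^+ _)) -exprSr.
  by rewrite addrCA -scalerDl alpha_iter_coef // scale0r addr0.
rewrite -(big_mkord xpredT
  (fun k => alpha N q M k *: (Q ^+ k * iter k D (Q * p)))).
(* The surviving term contains D^(M/2) p, of degree M - 2 - 2 floor(M/2) < 0. *)
rewrite H // (hom_neg _ (hom_iterD M./2 hp)) ?mulr0 ?scaler0 //; lia.
Qed.

End Projector.

(** * From the defining relations on ordinals to the abstract setting *)

Section Relations.
Variables (F : fieldType) (L : algType F) (N : nat) (q s : F) (x : 'I_N -> L).
Hypothesis N_gt2 : (2 < N)%N.
Hypothesis q_neq0 : q != 0.
Hypothesis q_nroot : forall k, (0 < k)%N -> q ^+ k != 1.
Hypothesis s_sqr : s ^+ 2 = q.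
Hypothesis two_neq0 : 2%:R != 0 :> F.
Hypothesis relator_eq0 : forall f, relator q s x f -> f = 0.
Local Notation n := N./2.
Local Notation r := (opp_index N).

Let s_neq0 : s != 0.
Proof. by move: q_neq0; rewrite -s_sqr expf_eq0. Qed.

Let q1p_neq0 : 1 + q != 0.
Proof.
rewrite addrC addr_eq0; apply: contraTneq (q_nroot (isT : 0 < 2)%N) => ->.
by rewrite sqrrN expr1n eqxx.
Qed.

Lemma exprz_neq1 (e : int) : e != 0 -> q ^ e != 1.
Proof.
case: e => [[|e]|e] // _; first by rewrite -exprnP q_nroot.
by rewrite NegzE -exprnN invr_eq1 q_nroot.
Qed.

Lemma kappa_neq0 : 1 + q ^+ (N - 2) != 0.
Proof.
rewrite addrC addr_eq0; apply/eqP => e.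
have /eqP[] : q ^+ ((N - 2) * 2) != 1 by rewrite q_nroot // muln_gt0; lia.
by rewrite exprM e sqrrN expr1n.
Qed.

(** If rho is 0 the weight is 2. Otherwise a vanishing weight would give q^(zrho j) = -1, so a
    nonzero power of q would be 1. *)
Lemma rho_weight_neq0 j : rho_weight N s j != 0.
Proof.
rewrite /rho_weight; case: (eqVneq (zrho N j) 0) => [->|z0].
  by rewrite oppr0 expr0z.
rewrite addr_eq0; apply/eqP => e.
have e1 : q ^ zrho N j = -1.
  rewrite -s_sqr expr2 expfzMl {2}e.
  by rewrite mulrN -expfzDr // subrr expr0z.
have /eqP[] : q ^ (zrho N j * 2) != 1 by apply: exprz_neq1; lia.
by rewrite -exprz_exp e1 -[_ ^ 2]/(_ ^+ 2) sqrrN expr1n.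
Qed.

Lemma rho_weight0 : rho_weight N s 0 = (1 + q ^+ (N - 2)) * q / s ^+ N.
Proof.
rewrite /rho_weight /zrho double0 subr0 opprB.
have -> : N%:Z - 2 = (N - 2)%N by lia.
have -> : 2 - N%:Z = - (N - 2)%N%:Z by lia.
have -> : s ^+ N = s ^+ (N - 2) * q by rewrite -s_sqr -exprD subnK // ltnW.
have -> : q ^+ (N - 2) = s ^+ (N - 2) * s ^+ (N - 2).
  by rewrite -s_sqr -exprM mul2n -addnn exprD.
by rewrite -exprnP -exprnN; field; rewrite q_neq0 expf_neq0.
Qed.

(** The generators, extended by 0 to all naturals, so that the results on families [nat -> L]
    apply. *)
Definition qgen_nat (i : nat) : L := oapp x 0 (insub i : option 'I_N).
Local Notation y := qgen_nat.

Lemma qgen_natE (i : 'I_N) : y i = x i.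
Proof. by rewrite /qgen_nat valK. Qed.

Lemma qgen_nat_opp (i : 'I_N) : y (r i) = x (rev_ord i).
Proof. by rewrite -qgen_natE. Qed.

Lemma rho2_rev (k : 'I_N) : rho2 (rev_ord k) = opp_rho2 N k.
Proof.
rewrite /rho2 /opp_rho2 /zrho /=; have := ltn_ord k.
by repeat case: ifP => ?; lia.
Qed.

Lemma big_ord_interval (R : Type) (idx : R) (op : Monoid.law idx)
    (G : nat -> R) a b :
  (b <= N)%N ->
  \big[op/idx]_(a <= k < b) G k = \big[op/idx]_(k < N | (a <= k < b)%N) G k.
Proof.
move=> bN; rewrite (big_nat_widen _ _ N) // big_geq_mkord.
by apply: eq_bigl => k; rewrite andbC.
Qed.

Lemma partialQ_ord j :
  partialQ N s y j
  = \sum_(k < N | (j <= k < N - j)%N)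
      s ^ rho2 (rev_ord k) *: (x k * x (rev_ord k)).
Proof.
rewrite /partialQ big_ord_interval ?leq_subr //.
by apply: eq_bigr => k _; rewrite rho2_rev qgen_nat_opp qgen_natE.
Qed.

Lemma qgen_nat_qcomm i j : (i < j < N)%N -> j != r i ->
  y i * y j = q *: (y j * y i).
Proof.
case/andP=> ij jN ji; have iN := ltn_trans ij jN.
have ne : Ordinal iN != rev_ord (Ordinal jN).
  by apply: contraNneq ji => /(congr1 val) /=; rewrite /opp_index; lia.
have := relator_eq0 (@rel_qcomm _ _ q s _ x (Ordinal iN) (Ordinal jN) ij ne).
move=> /eqP; rewrite subr_eq0 => /eqP.
by rewrite [y i](qgen_natE (Ordinal iN)) [y j](qgen_natE (Ordinal jN)).
Qed.

(** The three relations for a conjugate pair take one form. For j + 1 < n, rho drops by 1 from j to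
    j + 1, which turns the denominator into [rho_weight N s j.+1]. For j + 1 = n the right side is
    (q - q^-1) times [core], that is (s - s^-1) x_(n+1)^2 for odd [N] and 0 for even [N]. *)
Lemma qgen_nat_conj j : (j < n)%N ->
  y (r j) * y j - y j * y (r j)
  = ((q - q^-1) / rho_weight N s j.+1) *: partialQ N s y j.+1.
Proof.
move=> jn; have jN : (j < N)%N by lia.
rewrite [y j](qgen_natE (Ordinal jN)) [y (r j)](qgen_nat_opp (Ordinal jN)).
case: (ltngtP j.+1 n) jn => // [jn _|jn _].
  have := relator_eq0 (@rel_conj _ _ q s _ x (Ordinal jN) jn).
  move=> /eqP; rewrite subr_eq0 => /eqP ->.
  rewrite partialQ_ord.
  congr (_ / _ *: _);
    rewrite /rho_weight /zrho /rho2 /= ltnW //; congr (s ^ _ + s ^ _); lia.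
have nN : (n < N)%N by lia.
have weight j' : (j' <= n)%N -> rho_weight N s j' != 0.
  by move=> _; apply: rho_weight_neq0.
rewrite jn (core_weight y q_neq0 s_sqr weight) scalerA divfK ?weight //.
rewrite /core; case: ifP => oN.
  have := relator_eq0
    (@rel_mid_odd _ _ q s _ x (Ordinal jN) (Ordinal nN) oN jn erefl).
  move=> /eqP; rewrite subr_eq0 => /eqP ->.
  rewrite [y n](qgen_natE (Ordinal nN)) scalerA; congr (_ *: _).
  have -> : s^-1 = s / q by rewrite -s_sqr; field.
  by field; rewrite q1p_neq0 q_neq0.
have := relator_eq0 (@rel_mid_even _ _ q s _ x (Ordinal jN) (negbT oN) jn).
by move=> ->; rewrite scaler0.
Qed.

Definition relQ : L :=
  \sum_(i < N) s ^ rho2 (rev_ord i) *: (x i * x (rev_ord i)).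

Lemma relQ_ordQ : relQ = ((1 + q ^+ (N - 2)) * q / s ^+ N) *: ordQ N q s y 0.
Proof.
rewrite -rho_weight0 -partialQE //; last 2 first.
- by move=> *; apply: rho_weight_neq0.
- exact: qgen_nat_conj.
by rewrite partialQ_ord subn0; apply: eq_bigl => k; rewrite ltn_ord.
Qed.

Definition relmon (nu : {ffun 'I_N -> nat}) : L := \prod_(i < N) x i ^+ nu i.

Lemma ordmon_relmon (f : nat -> nat) :
  ordmon N y f = relmon [ffun i : 'I_N => f i].
Proof.
rewrite /ordmon /relmon big_mkord.
by apply: eq_bigr => i _; rewrite qgen_natE ffunE.
Qed.

Lemma relmon_ordmon nu :
  relmon nu = ordmon N y (fun i => oapp nu 0%N (insub i : option 'I_N)).
Proof.
rewrite ordmon_relmon; congr relmon.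
by apply/ffunP => i; rewrite ffunE valK.
Qed.

Lemma relQ_ordmon f : relQ * ordmon N y f =
  ((1 + q ^+ (N - 2)) * q / s ^+ N) *:
    (\sum_(l < uphalf N) raise_coef N q s l f *: ordmon N y (raise N l f)).
Proof.
rewrite relQ_ordQ -scalerAl (ordQ_ordmon q_neq0 s_sqr) ?big_mkord //.
- by move=> *; apply: rho_weight_neq0.
- exact: qgen_nat_qcomm.
- exact: qgen_nat_conj.
Qed.

Lemma dshift_outer (f : nat -> nat) (j : 'I_N) : (j < n)%N ->
  dshift [ffun i : 'I_N => f i] j = outer_degree N j f.
Proof.
move=> jn; rewrite /dshift.
have -> : (\sum_(k < N | k < j) ([ffun i : 'I_N => f i] k
    + [ffun i : 'I_N => f i] (rev_ord k))
    = \sum_(0 <= k < j) (f k + f (r k)))%N.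
  rewrite big_ord_interval ?(ltnW (ltn_ord j)) //.
  by apply: eq_bigr => k _; rewrite !ffunE.
elim: (val j) jn => [|k IH] kn; first by rewrite /outer_degree subn0 !big_geq.
by rewrite big_nat_recr //= outerS ?IH ?addnA // ltnW.
Qed.

Variable D : {linear L -> L}.
Hypothesis D_laplace : forall nu, D (relmon nu) =
  ((1 + q ^+ (N - 2)) * q ^ ((mdegree nu)%:Z - 1)) *:
  (\sum_(j < N | (j < N./2)%N)
      (qint_sym q (nu j)%:Z * qint_sym q (nu (rev_ord j))%:Z
        * s ^ (- rho2 j + (dshift nu j).*2%:Z)) *: relmon (mlower nu j)
   + \sum_(c < N | odd N && (c == N./2 :> nat))
      (qint q ((nu c)%:Z - 1) * qint q (nu c)%:Z
        * (q ^ ((mdegree nu)%:Z - (nu c).*2%:Z + 2) / (1 + q)))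
          *: relmon (mlower nu c)).

Lemma D_ordmon f : D (ordmon N y f) =
  ((1 + q ^+ (N - 2)) * q ^ ((total_degree N f)%:Z - 1)) *:
    (\sum_(k < uphalf N) lower_coef N q s k f *: ordmon N y (lower N k f)).
Proof.
rewrite {1}ordmon_relmon D_laplace.
set nu := [ffun i => _].
have nuE (i : 'I_N) : nu i = f i by rewrite ffunE.
have -> : mdegree nu = total_degree N f.
  by rewrite /mdegree /total_degree big_mkord; apply: eq_bigr.
have lowE (j : 'I_N) : ordmon N y (lower N j f) = relmon (mlower nu j).
  rewrite ordmon_relmon; congr relmon; apply/ffunP => i.
  by rewrite !ffunE /lower -!val_eqE.
congr (_ *: _).
rewrite -(big_mkord xpredT
  (fun k => lower_coef N q s k f *: ordmon N y (lower N k f))).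
rewrite big_ord_interval; last lia.
(* Indices below n match the first sum of the Laplacian; the only other index below [uphalf N] is
   the middle one, present for odd [N]. *)
rewrite [RHS](bigID (fun k : 'I_N => (k < n)%N)) /=; congr (_ + _).
  apply: eq_big => [k|k kn]; first lia.
  rewrite lowE !nuE /lower_coef kn dshift_outer //; congr (_ *: _).
  rewrite /qint_sym -!exprnP -!exprnN -[RHS]mulrA; congr (_ * _).
  rewrite -s_sqr -!exprM exprnN !exprnP -!expfzDr //; congr (s ^ _).
  rewrite /rho2 kn; lia.
apply: eq_big => [k|k /andP[oN /eqP kn]]; first lia.
rewrite lowE !nuE /lower_coef kn ltnn; congr (_ *: _).
rewrite /qint (expfzDr _ (- 1)) // -exprnP exprN1 total_odd //.
have -> : q ^ ((outer_degree N n f + f n)%N%:Z - (f n).*2%:Z + 2)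
    = q ^+ outer_degree N n f * q ^+ 2 / q ^+ f n.
  by rewrite exprnN !exprnP -!expfzDr //; congr (q ^ _); lia.
have q1' : 1 - q != 0 by rewrite subr_eq0 eq_sym -[q]expr1 q_nroot.
by field; rewrite q1p_neq0 q1' q_neq0 expf_neq0.
Qed.

Lemma homog_relmon (m : int) (c : {ffun 'I_N -> nat} -> F) rs :
  (forall nu, nu \in rs -> (mdegree nu)%:Z = m) ->
  homog N y m (\sum_(nu <- rs) c nu *: relmon nu).
Proof.
elim: rs => [|nu rs IH] deg; first by rewrite big_nil; constructor.
rewrite big_cons relmon_ordmon; apply: homog_cons.
  rewrite -(deg nu) ?mem_head // /total_degree /mdegree big_mkord; congr Posz.
  by apply: eq_bigr => i _; rewrite valK.
by apply: IH => mu hmu; apply: deg; rewrite in_cons hmu orbT.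
Qed.

(** By linearity: on [h] only the term k = 0 survives, with coefficient 1, and the contribution of
    [relQ * u] is 0 by [sum_alpha_Q]. *)
Lemma harmonic_part_formula M h u p : D h = 0 -> homog N y (M%:Z - 2) u ->
  p = h + relQ * u ->
  h = \sum_(k < (M./2).+1) alpha N q M k *: iter k ( *%R relQ) (iter k D p).
Proof.
move=> Dh hu ->.
under eq_bigr do rewrite iter_mulr iterDD mulrDr scalerDr.
rewrite big_split /= (@sum_alpha_Q _ _ _ _ _ D (homog N y)) //; last 5 first.
- exact: kappa_neq0.
- exact: (homog_D q_neq0 q_nroot s_sqr D_ordmon).
- exact: homog_lt0.
- exact: (D_Q_homog q_neq0 q_nroot s_sqr D_ordmon relQ_ordmon).
- exact: ltnW (ltnW N_gt2).
rewrite addr0 big_ord_recl /= alpha0 expr0 mul1r scale1r big1 ?addr0 // => k _.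
by rewrite -[D (iter _ D h)]iterS iterSr Dh iterD0 mulr0 scaler0.
Qed.

End Relations.

(** * Transfer of the relations to the quotient algebra, and the projector formula *)

Lemma relator_morph (F : fieldType) (N : nat) (q s : F) (L L' : lalgType F)
    (X : 'I_N -> L) (phi : L -> L') (f' : L') :
  phi 0 = 0 -> {morph phi : f g / f + g} -> {morph phi : f g / f - g} ->
  (forall c f, phi (c *: f) = c *: phi f) -> {morph phi : f g / f * g} ->
  relator q s (phi \o X) f' -> exists2 f, relator q s X f & phi f = f'.
Proof.
move=> phi0 phiD phiB phiZ phiM; case=> [i j ij ne|i iN|i c oN iN cN|i oN iN].
- by eexists; [exact: rel_qcomm ij ne|rewrite phiB phiZ !phiM].
- eexists; first exact: rel_conj iN.
  rewrite !phiB phiZ !phiM (big_morph phi phiD phi0).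
  by under eq_bigr do rewrite phiZ phiM.
- by eexists; [exact: rel_mid_odd oN iN cN|rewrite !phiB phiZ !phiM].
- by eexists; [exact: rel_mid_even oN iN|rewrite phiB !phiM].
Qed.

Section QuantumSpace.
Variables (F : fieldType) (N : nat) (q s : F).
Local Notation X := (@freeGen F N).
Local Notation pi := (@qproj F N q s).

Lemma qproj0 : pi 0 = 0.
Proof. exact: (raddf0 \pi_({ideal_quot relIdeal q s})%qT). Qed.

Lemma qprojB f g : pi (f - g) = pi f - pi g.
Proof. exact: (raddfB \pi_({ideal_quot relIdeal q s})%qT). Qed.

Lemma qproj_mul f g : pi (f * g) = pi f * pi g.
Proof. by rewrite -[RHS]/(qmul (pi f) (pi g)) qprojM. Qed.

Lemma qproj_scale c f : pi (c *: f) = c *: pi f.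
Proof. by rewrite -[RHS]/(qscale c (pi f)) qprojZ. Qed.

Lemma relator_qproj f : relator q s X f -> pi f = 0.
Proof.
move=> rf; rewrite -qproj0; apply/eqP; rewrite qproj_eq subr0.
by apply/relIdealP => J _; apply.
Qed.


Lemma relator_qgen (f : qspace N q s) : relator q s (@qgen F N q s) f -> f = 0.
Proof.
case/(relator_morph (phi := pi) (X := X) qproj0 (@qprojD _ _ _ _) qprojB
  qproj_scale qproj_mul) => g rg <-; exact: relator_qproj.
Qed.

End QuantumSpace.

Theorem mainTheorem1 (R : realType) (N : nat) (q s : R[i]) (m : nat)
    (Delta : {linear qspace N q s -> qspace N q s})
    (H : qspace N q s -> qspace N q s) (p : qspace N q s) :
  (3 <= N)%N ->
  q != 0 ->
  (forall k : nat, (0 < k)%N -> q ^+ k != 1) ->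
  s ^+ 2 = q ->
  is_qlaplace Delta ->
  projector_along (homogeneous m%:Z) (harmonic Delta m)
    (Qmultiple q s m) H ->
  homogeneous m%:Z p ->
  H p = \sum_(k < (m./2).+1)
    alpha N q m k *: iter k (Qhat q s) (iter k Delta p).
Proof.
move=> N_gt2 q_neq0 q_nroot s_sqr DeltaE Hproj.
(* The projector property provides [u], homogeneous of degree m - 2, with p - H p = Q u. *)
move=> /Hproj [[_ DHp] [u [rs [c [deg uE]]] pE]].
have two_neq0 : 2%:R != 0 :> R[i] by rewrite Num.Theory.pnatr_eq0.
have DE := harmonic_part_formula N_gt2 q_neq0 q_nroot s_sqr two_neq0
  (@relator_qgen R[i] N q s) DeltaE DHp.
apply: (DE m u).
  by rewrite uE; apply: homog_relmon.
by rewrite -[RHS]addrC -[relQ _ _ * u]/(Qhat q s u) -pE subrK.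
Qed.
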